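(* Let $(\mathcal D_n)_{n\ge1}$ be a family where each $\mathcal D_n$ is a probability distribution over permutations of $[n]$ with Shannon entropy $H(\mathcal D_n)=o(\log\log n)$. Then the family is not s-admissible.
   Context: Secretary problem: there are $n$ items $[n]$; an adversary assigns distinct values to the items; nature draws an arrival order $\pi\sim\mathcal D_n$ ($\pi(i)$ is the arrival time of item $i$), independently of the values; an online algorithm observes items one at a time in this order and, at the arrival of each item, must irrevocably decide whether to select it (selecting at most one item). Algorithms are comparison-based (possibly randomized): the decision at time $t$ depends only on the relative order of the values of the first $t$ arrived items (and internal randomness). The algorithm succeeds if it selects the item of maximum value. The family $(\mathcal D_n)$ is s-admissible if there exist a constant $c>0$ and $n_0$ such that for every $n\ge n_0$ there is an algorithm whose success probability is at least $c$ for every value assignment. *)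

(* Defs.v *)
From HB Require Import structures.
From mathcomp Require Import all_boot all_order all_algebra all_fingroup.
From mathcomp Require Import all_classical all_reals all_analysis.

Set Implicit Arguments.
Unset Strict Implicit.
Unset Printing Implicit Defensive.

Import Order.TTheory GRing.Theory Num.Theory.
Import numFieldNormedType.Exports.

Local Open Scope classical_set_scope.
Local Open Scope ring_scope.

Definition is_distribution (R : realType) (T : finType) (p : T -> R) : Prop :=
  (forall x, 0 <= p x) /\ \sum_x p x = 1.

(* Since [ln 0 = 0], outcomes of probability 0 contribute 0. The choice of
   natural logarithms only affects the entropy by a constant factor. *)
Definition entropy (R : realType) (T : finType) (p : T -> R) : R :=
  - \sum_x p x * ln (p x).

Definition rel_order (t : nat) := {ffun 'I_t * 'I_t -> bool}.

(* Times are counted from 0, so [t.+1] items have arrived at time [t]. As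
   [pi i] is the arrival time of item [i], the item arriving at time [j] is
   [(pi^-1)%g j]. *)
Definition observed (R : realType) (n : nat) (v : 'I_n -> R) (pi : 'S_n)
    (t : 'I_n) : rel_order t.+1 :=
  let w (j : 'I_t.+1) := v ((pi^-1)%g (widen_ord (ltn_ord t) j)) in
  [ffun jk => w jk.1 < w jk.2].

(* A randomized comparison-based algorithm. The internal randomness is a point
   [w] of an arbitrary probability space, drawn once at the start;
   [select r w], for [r : rel_order t.+1], tells whether the algorithm, unless
   it has stopped before, selects the item arriving at time [t]. *)
Record algorithm (R : realType) (n : nat) := Algorithm {
  seed_display : measure_display;
  seed : measurableType seed_display;
  seed_law : probability seed R;
  select : forall t : 'I_n, rel_order t.+1 -> seed -> bool;
  select_measurable : forall (t : 'I_n) (r : rel_order t.+1),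
    measurable_fun [set: seed] (select r)
}.

Definition selects_at (R : realType) (n : nat) (A : algorithm R n)
    (v : 'I_n -> R) (pi : 'S_n) (w : seed A) (t : 'I_n) : Prop :=
  select (observed v pi t) w /\
  forall u : 'I_n, (u < t)%N -> ~~ select (observed v pi u) w.

Definition succeeds (R : realType) (n : nat) (A : algorithm R n)
    (v : 'I_n -> R) (pi : 'S_n) (w : seed A) : Prop :=
  exists t : 'I_n, selects_at v pi w t /\
    forall i : 'I_n, v i <= v ((pi^-1)%g t).

(* Probability of success when the arrival order, of law [p], and the internal
   randomness are independent. *)
Definition success_prob (R : realType) (n : nat) (p : 'S_n -> R)
    (A : algorithm R n) (v : 'I_n -> R) : \bar R :=
  (\sum_(pi : 'S_n) (p pi)%:E * seed_law A [set w | succeeds v pi w])%E.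

Definition s_admissible (R : realType) (D : forall n : nat, 'S_n -> R) : Prop :=
  exists (c : R) (n0 : nat), 0 < c /\
    forall n : nat, (0 < n)%N -> (n0 <= n)%N ->
      exists A : algorithm R n,
        forall v : 'I_n -> R, injective v -> (c%:E <= success_prob (D n) A v)%E.

(* Main.v *)
Require Import Defs.
From HB Require Import structures.
From mathcomp Require Import all_boot all_order all_algebra all_fingroup.
From mathcomp Require Import all_classical all_reals all_analysis.
From mathcomp Require Import ring lra.
Import Order.TTheory GRing.Theory Num.Theory.
Import numFieldNormedType.Exports.

Set Implicit Arguments.
Unset Strict Implicit.
Unset Printing Implicit Defensive.

(* By Markov's inequality for [- ln p], all but a small mass of the arrival order
   is carried by a set [S] of at most [sqrt (ln n)] permutations. Given [S], the
   adversary draws items [x_1, x_2, ...] as follows: starting from the set [M]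
   of all items, [x_j] and [y] are independent uniform in [M], and [M] is
   replaced by the items lying on the same side of [x_j] as [y] in every
   permutation of [S]. This divides the size of [M] by about [2 ^ #|S|], so that
   any fixed number [s] of steps can be made when [n] is large. The adversary
   picks [tau] uniformly in [1, s] and gives increasing values to
   [x_1, ..., x_tau] and lower values to all other items. Fix a permutation of
   [S]. When [x_j] arrives as a record, nothing observed so far tells whether
   [j = tau], except for the position of [x_j] in [M]. If the algorithm would
   select [x_j] with probability [a], then with probability about [a ^ 2 / 2] it
   selects [x_j] while the later [x_i] all arrive after [x_j], which loses if
   [j < tau]. Such a premature stop happens only once, so the sum of the [a ^ 2]
   is bounded and the success probability is [O(1 / sqrt s)]. *)

Local Open Scope classical_set_scope.
Local Open Scope ring_scope.

(** * The adversary's nested process and its expected payoff *)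

Section LayeredSum.
Variables (R : realType) (T U : finType) (sig : T -> T -> U).
Implicit Types (g : seq T -> R) (l : seq T) (M : {set T}).

Definition same_side M (x y : T) : {set T} :=
  [set z in M :\ x | sig x z == sig x y].

(* The expected value of [g [:: x_1] + ... + g [:: x_1; ...; x_s]] (after the
   prefix [l]), where [x_1] is uniform in [M] and the process continues in
   [same_side M x_1 y] for an independent uniform [y] in [M]; it dies if
   [y = x_1]. *)
Fixpoint layered_sum g (s : nat) l M : R :=
  if s is s'.+1 then
    #|M|%:R^-1 * \sum_(x in M) (g (rcons l x) +
      #|M|%:R^-1 *
        \sum_(y in M :\ x) layered_sum g s' (rcons l x) (same_side M x y))
  else 0.

Lemma layered_sum_lin (I : finType) (a : I -> R) (g : I -> seq T -> R) s l M :
  layered_sum (fun l => \sum_i a i * g i l) s l M =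
  \sum_i a i * layered_sum (g i) s l M.
Proof.
elim: s l M => [|s IHs] l M /=; first by rewrite big1 // => i _; rewrite mulr0.
under [RHS]eq_bigr do rewrite mulrCA.
rewrite -mulr_sumr; congr (_ * _).
under [RHS]eq_bigr do rewrite mulr_sumr.
rewrite exchange_big; apply: eq_bigr => x _ /=.
under [RHS]eq_bigr do rewrite mulrDr.
rewrite big_split; congr (_ + _).
under [RHS]eq_bigr do rewrite mulrCA.
rewrite -mulr_sumr; congr (_ * _).
under [RHS]eq_bigr do rewrite mulr_sumr.
by rewrite exchange_big; apply: eq_bigr => y _.
Qed.

Lemma mean_le (M : {set T}) (f : T -> R) (b : R) : 0 <= b ->
  {in M, forall x, f x <= b} -> #|M|%:R^-1 * \sum_(x in M) f x <= b.
Proof.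
(* The mean over an empty [M] is [0], as [0^-1 = 0]; [0 <= b] covers this case. *)
move=> b0 fb; have [->|M0] := eqVneq #|M| 0%N; first by rewrite invr0 mul0r.
rewrite ler_pdivrMl ?ltr0n ?lt0n // mulrC mulr_natr -sumr_const.
exact: ler_sum.
Qed.

Lemma layered_sum_le g s l M :
  (forall l, g l <= 1) -> layered_sum g s l M <= s%:R.
Proof.
move=> g1; elim: s l M => //= s IHs l M.
apply: mean_le => // x xM; rewrite -natr1 addrC lerD //.
apply: le_trans (_ : #|M|%:R^-1 * \sum_(y in M) s%:R <= _); last exact: mean_le.
rewrite ler_wpM2l ?invr_ge0 //.
apply: le_trans (_ : \sum_(y in M :\ x) s%:R <= _); first exact: ler_sum.
by rewrite (big_setD1 x xM) /= lerDr.
Qed.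

(** A fiber with [m] elements contributes [m] times [1 / m]. Hence one step of the process
    multiplies the expected inverse size of [M] by at most the number of signatures. *)
Lemma sum_inv_card_fiber (N : {set T}) (f : T -> U) :
  \sum_(y in N) (#|[set z in N | f z == f y]|%:R : R)^-1 = #|f @: N|%:R.
Proof.
rewrite (partition_big_imset f) /= -sum1_card natr_sum.
apply: eq_bigr => u /imsetP[y0 y0N ->].
set C := [set z in N | f z == f y0].
under eq_bigr => y /andP[_ /eqP ->] do over.
rewrite (eq_bigl (mem C)) => [|y]; last by rewrite !inE.
rewrite sumr_const -[LHS]mulr_natr mulVf // pnatr_eq0 -lt0n.
by apply/card_gt0P; exists y0; rewrite !inE y0N eqxx.
Qed.

Lemma sum_inv_card_same_side K M x : (#|sig x @: M| <= K)%N ->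
  \sum_(y in M :\ x) (#|same_side M x y|%:R : R)^-1 <= K%:R.
Proof.
move=> leK; rewrite sum_inv_card_fiber ler_nat.
by apply: leq_trans leK; rewrite subset_leq_card // imsetS // subD1set.
Qed.

Lemma same_side_refl M x y : y \in M :\ x -> y \in same_side M x y.
Proof. by move=> yM; rewrite inE yM eqxx. Qed.

Lemma mean_ge (M : {set T}) (f : T -> R) (b : R) : (0 < #|M|)%N ->
  {in M, forall x, b <= f x} -> b <= #|M|%:R^-1 * \sum_(x in M) f x.
Proof.
move=> M0 fb; rewrite ler_pdivlMl ?ltr0n // mulrC mulr_natr -sumr_const.
exact: ler_sum.
Qed.

(** Each step that is reached earns at least [c], and the process dies in it with probability
    [1 / #|M|]. The expected inverse size grows by a factor of at most [K] per step, which gives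
    [K ^ s]; the factor [s ^ 2] lets the induction close. *)
Lemma layered_sum_ge g K (c : R) s l M : 0 <= c ->
  (forall x M, #|sig x @: M| <= K)%N ->
  (forall l, c <= g l) -> (0 < #|M|)%N ->
  c * s%:R - c * s%:R ^+ 2 * K%:R ^+ s / #|M|%:R <= layered_sum g s l M.
Proof.
move=> c0 leK gc; elim: s l M => [|s IHs] l M M0.
  by rewrite /= expr0n /= !mulr0 !mul0r subr0.
have K1 : (1 <= K)%N.
  have /card_gt0P[x xM] := M0; apply: leq_trans (leK x M).
  by apply/card_gt0P; exists (sig x x); apply: imset_f.
have mp : 0 < #|M|%:R :> R by rewrite ltr0n.
set E := c * s%:R ^+ 2 * K%:R ^+ s.
have E0 : 0 <= E by rewrite !mulr_ge0 ?exprn_ge0.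
rewrite /=; apply: mean_ge => // x xM.
apply: le_trans (_ : c + #|M|%:R^-1 * (c * s%:R * (#|M|%:R - 1) - E * K%:R) <= _).
  have -> : c * s.+1%:R - c * s.+1%:R ^+ 2 * K%:R ^+ s.+1 / #|M|%:R =
    c + c * s%:R - c * s.+1%:R ^+ 2 * K%:R ^+ s.+1 / #|M|%:R.
    by rewrite -natr1 mulrDr mulr1 [c * _ + c]addrC.
  rewrite -addrA lerD2l -(ler_pM2r mp) mulrBl divfK ?gt_eqF //.
  rewrite [leRHS]mulrAC mulVf ?gt_eqF // mul1r mulrBr mulr1 -addrA lerD2l -opprD lerN2.
  have -> : E * K%:R = c * s%:R ^+ 2 * K%:R ^+ s.+1 by rewrite /E -[LHS]mulrA -exprSr.
  have K1R : 1 <= K%:R ^+ s.+1 :> R by rewrite exprn_ege1 // ler1n.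
  have s0 : 0 <= s%:R :> R by [].
  rewrite -natr1 -!mulrA -mulrDr ler_wpM2l //; nra.
rewrite lerD // ler_wpM2l ?invr_ge0 //.
have cardMx : #|M|%:R - 1 = #|M :\ x|%:R :> R.
  by rewrite (cardsD1 x) xM natrD addrAC subrr add0r.
apply: le_trans (_ : \sum_(y in M :\ x)
   (c * s%:R - E * (#|same_side M x y|%:R)^-1) <= _).
  rewrite big_split /= sumr_const -[c * s%:R *+ _]mulr_natr -cardMx lerD2l.
  by rewrite sumrN lerN2 -mulr_sumr ler_wpM2l // sum_inv_card_same_side.
apply: ler_sum => y yM; apply: IHs.
by apply/card_gt0P; exists y; apply: same_side_refl.
Qed.

(** Exactly one of the two orders of a pair of distinct items is increasing. This is the source of
    the [a ^ 2 / 2]. *)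
Lemma sum_ordered_pairs (arr : T -> nat) (A : {set T}) : injective arr ->
  ((\sum_(x in A) \sum_(y in A) (arr x < arr y)) * 2 = #|A| * #|A|.-1)%N.
Proof.
move=> arr_inj; rewrite muln2 -addnn [X in (_ + X)%N]exchange_big /=.
rewrite -big_split /= -sum_nat_const; apply: eq_bigr => x xA.
rewrite -big_split /= (big_setD1 x xA) /= ltnn add0n.
have -> : #|A|.-1 = #|A :\ x| by rewrite (cardsD1 x) xA.
rewrite -sum1_card; apply: eq_bigr => y; rewrite !inE => /andP[yx _].
by case: ltngtP => // /arr_inj xy; rewrite xy eqxx in yx.
Qed.

(** * Upper bound for one deterministic algorithm and one arrival order *)

Section StoppingRule.
(* [arr] gives arrival times and [sel l x] says whether the algorithm wants to
   select [x] when the chosen layers are [l]. *)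
Variables (arr : T -> nat) (sel : seq T -> T -> bool) (g : seq T -> R).
Hypothesis arr_inj : injective arr.
Hypothesis sel_rcons : forall l x z, (arr x < arr z)%N ->
  sel (rcons l z) x = sel l x.
Hypothesis sig_arr : forall x y z, sig x z = sig x y ->
  (arr x < arr z)%N = (arr x < arr y)%N.
Hypothesis g_le1 : forall l x, g (rcons l x) <= 1.
Hypothesis g_le0 : forall l x, x \notin l ->
  ~~ (sel (rcons l x) x &&
      [forall u, (arr u < arr x)%N ==> ~~ sel (rcons l x) u]) ->
  g (rcons l x) <= 0.

(** All further layers arrive after [x], so they leave the decision at [x] unchanged: the algorithm
    stops at [x] or before and misses each of them. *)
Lemma layered_sum_stopped s l M x : sel l x -> {in M, forall z, z \notin l} ->
  {in M, forall z, (arr x < arr z)%N} -> layered_sum g s l M <= 0.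
Proof.
elim: s l M => //= s IHs l M lx Ml Mx; apply: mean_le => // z zM.
rewrite -[leRHS]addr0 lerD //.
  apply: g_le0; first exact: Ml.
  rewrite negb_and; apply/orP; right; rewrite negb_forall; apply/existsP.
  by exists x; rewrite Mx //= negbK sel_rcons ?Mx.
rewrite pmulr_rle0 ?invr_gt0 ?ltr0n; last by apply/card_gt0P; exists z.
apply: sumr_le0 => y _; apply: IHs; first by rewrite sel_rcons ?Mx.
- move=> u; rewrite !inE mem_rcons inE => /andP[/andP[uz uM] _].
  by rewrite (negbTE uz) /= Ml.
- by move=> u; rewrite !inE => /andP[/andP[_ uM] _]; apply: Mx.
Qed.

(** The term [2 / d] is a potential that is lost when the algorithm stops too early; this loss pays
    for [a ^ 2 / d] in [a <= d + a ^ 2 / d], while [d * s] pays for the [d] of every step. The last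
    term collects the corrections for ties [x = y]. *)
Lemma layered_sum_upper K (d : R) s l M : 0 < d ->
  (forall x M, #|sig x @: M| <= K)%N -> {in M, forall z, z \notin l} ->
  layered_sum g s l M <=
    2 / d + d * s%:R + s%:R * K%:R ^+ s / d / #|M|%:R.
Proof.
move=> d0 leK; elim: s l M => [|s IHs] l M Ml.
  by rewrite /= mulr0 !mul0r !addr0 divr_ge0 // ltW.
have [M0|M0] := posnP #|M|.
  rewrite /= M0 invr0 mul0r mulr0 addr0 addr_ge0 ?mulr_ge0 ?invr_ge0 //; lra.
have K1 : (1 <= K)%N.
  have /card_gt0P[x xM] := M0; apply: leq_trans (leK x M).
  by apply/card_gt0P; exists (sig x x); apply: imset_f.
have mp : 0 < #|M|%:R :> R by rewrite ltr0n.
set E := s%:R * K%:R ^+ s / d.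
have E0 : 0 <= E by rewrite !mulr_ge0 ?exprn_ge0 // invr_ge0 ltW.
set b := 2 / d + d * s%:R.
have b0 : 0 <= b by rewrite addr_ge0 ?mulr_ge0 ?invr_ge0 //; lra.
have b2 : 2 / d <= b by rewrite lerDl mulr_ge0 // ltW.
have bS : b + d = 2 / d + d * s.+1%:R.
  by rewrite /b -[s.+1%:R]natr1 mulrDr mulr1 addrA.
have ES : E * K%:R + d^-1 <= s.+1%:R * K%:R ^+ s.+1 / d.
  rewrite /E mulrAC -[_ * K%:R]mulrA -exprSr -[leLHS]/(_ / d + _).
  rewrite -[X in _ + X]mul1r -mulrDl ler_pM2r ?invr_gt0 //.
  by rewrite -[s.+1%:R]natr1 mulrDl lerD2l mul1r exprn_ege1 // ler1n.
have {IHs} IHs l' M' : {in M', forall z, z \notin l'} ->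
  layered_sum g s l' M' <= b + E / #|M'|%:R by apply: IHs.
rewrite -bS; clearbody b E.
(* If [x] and [y] are independent uniform in [M], the probability [a] that [x]
   is selected is at most [d + a ^ 2 / d], and [a ^ 2 / 2] is, up to ties, at
   most the probability that [x] is selected and the process continues after
   [x], i.e., that the algorithm has stopped too early. *)
pose A := [set x in M | sel (rcons l x) x].
pose N x := (\sum_(y in A) (arr x < arr y))%N.
have step x : x \in M -> g (rcons l x) + #|M|%:R^-1 *
    \sum_(y in M :\ x) layered_sum g s (rcons l x) (same_side M x y) <=
    (x \in A)%:R + (b - 2 / d / #|M|%:R * ((x \in A) * N x)%:R
                   + E * K%:R / #|M|%:R).
  move=> xM; rewrite lerD //.
    have [xA|] := boolP (x \in A); first exact: g_le1.
    rewrite inE xM /= => xA; apply: g_le0; first exact: Ml.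
    by rewrite negb_and xA.
  have rM y : {in same_side M x y, forall z, z \notin rcons l x}.
    move=> u; rewrite !inE mem_rcons inE => /andP[/andP[uz uM] _].
    by rewrite (negbTE uz) /= Ml.
  rewrite -(ler_pM2l mp) mulVKf ?gt_eqF //.
  (* After a premature stop the continuation is worth at most [0], and [2 / d <= b] makes room for
     the subtracted [2 / d]. *)
  apply: le_trans (_ : \sum_(y in M :\ x) (b -
     2 / d * ((x \in A) * ((y \in A) && (arr x < arr y)%N))%:R
     + E * (#|same_side M x y|%:R)^-1) <= _).
    apply: ler_sum => y yM.
    have [/and3P[xA yA xy]|nxy] :=
        boolP [&& x \in A, y \in A & (arr x < arr y)%N].
      rewrite xA yA xy /= mulr1; apply: le_trans (_ : 0 <= _).
        apply: (@layered_sum_stopped _ _ _ x).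
        - by move: xA; rewrite inE => /andP[].
        - exact: rM.
        - move=> z; rewrite inE => /andP[_ /eqP zy].
          by rewrite (sig_arr zy).
      have : 0 <= E / #|same_side M x y|%:R by rewrite mulr_ge0 ?invr_ge0.
      lra.
    have -> : ((x \in A) * ((y \in A) && (arr x < arr y)%N) = 0)%N.
      by move: nxy; case: (x \in A) => //= /negbTE ->.
    by rewrite mulr0 subr0; apply: IHs.
  rewrite !big_split /= sumrN -!mulr_sumr sumr_const -[b *+ _]mulr_natl.
  rewrite !mulrDr lerD //.
    rewrite lerD // ?ler_wpM2r ?ler_nat ?subset_leq_card ?subD1set //.
    rewrite mulrN lerN2 [leLHS]mulrCA [leLHS]mulrA divfK ?gt_eqF //.
    rewrite ler_wpM2l ?divr_ge0 ?(ltW d0) // -natr_sum ler_nat -big_distrr /=.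
    rewrite leq_mul // /N big_mkcond [leqRHS]big_mkcond leq_sum //= => i _.
    have [iA|] := boolP (i \in A); last by case: ifP.
    have [ix|//] := boolP (arr x < arr i)%N.
    have -> : i \in M :\ x.
      rewrite !inE; move: iA; rewrite inE => /andP[-> _]; rewrite andbT.
      by apply: contraTneq ix => ->; rewrite ltnn.
    by [].
  rewrite mulrCA divff ?gt_eqF // mulr1 ler_wpM2l //.
  exact: sum_inv_card_same_side.
rewrite /=; apply: le_trans (_ : #|M|%:R^-1 * \sum_(x in M) _ <= _).
  by rewrite ler_wpM2l ?invr_ge0 //; apply: ler_sum step.
have AM : A \subset M by apply/fintype.subsetP => x; rewrite inE => /andP[].
set P := (\sum_(x in A) N x)%N.
have PE : 2 * P%:R = #|A|%:R ^+ 2 - #|A|%:R :> R.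
  rewrite -natrM mulnC sum_ordered_pairs //; case: #|A| => [|k].
    by rewrite expr0n subr0.
  by rewrite natrM /= -[k.+1%:R]natr1; ring.
have sumA (f : T -> nat) :
    \sum_(x in M) ((x \in A) * f x)%:R = (\sum_(x in A) f x)%:R :> R.
  rewrite natr_sum [LHS]big_mkcond [RHS]big_mkcond /=; apply: eq_bigr => x _.
  have [xA|_] := boolP (x \in A); first by rewrite (fintype.subsetP AM) ?mul1n.
  by rewrite mul0n; case: ifP.
have -> : \sum_(x in M) ((x \in A)%:R +
      (b - 2 / d / #|M|%:R * ((x \in A) * N x)%:R + E * K%:R / #|M|%:R)) =
   #|A|%:R + (#|M|%:R * b - 2 / d / #|M|%:R * P%:R + E * K%:R) :> R.
  rewrite !big_split /= sumrN -mulr_sumr sumA !sumr_const.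
  rewrite -[b *+ _]mulr_natl -[E * K%:R / _ *+ _]mulr_natr divfK ?gt_eqF //.
  congr (_ + _); rewrite -sum1_card -sumA; apply: eq_bigr => x _.
  by rewrite muln1.
set i := d^-1 in ES *; set r := #|M|%:R^-1.
have di : d * i = 1 by rewrite divff ?gt_eqF.
have mr : #|M|%:R * r = 1 by rewrite divff ?gt_eqF.
have i0 : 0 < i by rewrite invr_gt0.
have r0 : 0 < r by rewrite invr_gt0.
(* [q] is the probability [a] that the next layer would be selected. *)
set q := #|A|%:R * r.
have q0 : 0 <= q by rewrite mulr_ge0 // ltW.
have q1 : q <= 1 by rewrite ler_pdivrMr // mul1r ler_nat subset_leq_card.
have -> : r * (#|A|%:R + (#|M|%:R * b - 2 * i * r * P%:R + E * K%:R)) =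
    q + b - i * (q ^+ 2 - q * r) + r * (E * K%:R).
  have -> : 2 * i * r * P%:R = i * r * (2 * P%:R) by ring.
  by rewrite PE /q; ring: mr.
have := ler_wpM2r (ltW r0) ES.
(* This is [q <= d + q ^ 2 / d]. *)
have : 0 <= i * (q ^+ 2 - q * d + d ^+ 2) by rewrite mulr_ge0 ?(ltW i0) //; nra.
have -> : i * (q ^+ 2 - q * d + d ^+ 2) = i * q ^+ 2 - q + d by ring: di.
have : i * (q * r) <= i * r by rewrite ler_pM2l // ler_piMl // ltW.
lra.
Qed.
End StoppingRule.
End LayeredSum.

(** * Value assignments that realize the layers *)

Section LayerValue.
Variables (R : realType) (n : nat).
Implicit Types (l : seq 'I_n) (pi : 'S_n).

(* The items of [l] get increasing nonnegative values, all others fixed negative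
   ones: appending a layer to [l] affects only observations made after its
   arrival. *)
Definition layer_value l (i : 'I_n) : R :=
  if i \in l then (index i l)%:R else - i.+1%:R.

Lemma layer_value_inj l : injective (layer_value l).
Proof.
move=> i j; rewrite /layer_value; case: ifP => il; case: ifP => jl.
- by move/eqP; rewrite eqr_nat => /eqP /index_inj; apply.
- by move=> /eqP; rewrite gt_eqF // (lt_le_trans _ (ler0n _ _)) // oppr_lt0.
- by move=> /eqP; rewrite lt_eqF // (lt_le_trans _ (ler0n _ _)) // oppr_lt0.
- by move/oppr_inj/eqP; rewrite eqr_nat => /eqP[/val_inj].
Qed.

Lemma layer_value_rcons l z i : i != z ->
  layer_value (rcons l z) i = layer_value l i.
Proof.
move=> iz; rewrite /layer_value mem_rcons inE (negbTE iz) /=.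
by case: ifP => // il; rewrite -cats1 index_cat il.
Qed.

Lemma layer_value_last l z i : z \notin l ->
  layer_value (rcons l z) z <= layer_value (rcons l z) i -> i = z.
Proof.
move=> zl; have [//|iz] := eqVneq i z; rewrite (layer_value_rcons _ iz).
rewrite /layer_value mem_rcons inE eqxx /= -cats1 index_cat (negbTE zl) /= eqxx addn0.
case: ifP => il; first by rewrite ler_nat leqNgt index_mem il.
by rewrite leNgt (lt_le_trans _ (ler0n _ _)) // oppr_lt0.
Qed.

Lemma observed_layer_value l z pi (t : 'I_n) : (t < pi z)%N ->
  observed (layer_value (rcons l z)) pi t = observed (layer_value l) pi t.
Proof.
move=> tz; apply/ffunP => -[j k]; rewrite !ffunE /=.
have vE (i : 'I_t.+1) :
    layer_value (rcons l z) ((pi^-1)%g (widen_ord (ltn_ord t) i)) =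
    layer_value l ((pi^-1)%g (widen_ord (ltn_ord t) i)).
  apply: layer_value_rcons; apply: contraTneq tz => <-.
  by rewrite permKV /= -leqNgt -ltnS.
by rewrite !vE.
Qed.

End LayerValue.

(** * Randomized algorithms as finite mixtures of deterministic ones *)

Section Behaviour.
Variables (R : realType) (n : nat).

(* The finitely many deterministic algorithms. *)
Definition behaviour := {ffun {t : 'I_n & rel_order t.+1} -> bool}.

Definition behaves (b : behaviour) (t : 'I_n) (r : rel_order t.+1) : bool :=
  b (Tagged (fun t : 'I_n => rel_order t.+1) r).

Definition behaviour_succeeds (v : 'I_n -> R) (pi : 'S_n) (b : behaviour) :=
  [exists t : 'I_n, [&& behaves b (observed v pi t),
    [forall u : 'I_n, (u < t)%N ==> ~~ behaves b (observed v pi u)] &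
    [forall i : 'I_n, v i <= v ((pi^-1)%g t)]]].

Definition behaviour_of (A : algorithm R n) (w : seed A) : behaviour :=
  [ffun tr => select (tagged tr) w].

Lemma succeedsP (A : algorithm R n) v pi (w : seed A) :
  succeeds v pi w <-> behaviour_succeeds v pi (behaviour_of w).
Proof.
have bE (t : 'I_n) (r : rel_order t.+1) : behaves (behaviour_of w) r = select r w.
  by rewrite /behaves ffunE.
split=> [[t [[st nst] mt]]|/existsP[t /and3P[st /forallP nst /forallP mt]]].
  apply/existsP; exists t; rewrite bE st /=; apply/andP; split; apply/forallP => //.
  by move=> u; apply/implyP => /nst; rewrite bE.
exists t; split=> //; split; first by rewrite -bE.
by move=> u ut; rewrite -bE; move: (nst u); rewrite ut.
Qed.
End Behaviour.

Lemma measure_finite_image d (T : measurableType d) (R : realType)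
    (mu : {measure set T -> \bar R}) (B : finType) (f : T -> B) (Q : pred B) :
  (forall b, measurable (f @^-1` [set b])) ->
  mu [set w | Q (f w)] = (\sum_(b | Q b) mu (f @^-1` [set b]))%E.
Proof.
move=> mf; have -> : [set w | Q (f w)] = \bigcup_(b in [set` Q]) f @^-1` [set b].
  by apply/seteqP; split=> [w /= Qw|w [b Qb /= ->]//]; exists (f w).
rewrite measure_fin_bigcup; last first.
- by move=> b _; apply: mf.
- by move=> b c _ _ [w [<- <-]].
- exact: finite_finset.
rewrite (fsbigE (enum Q)) ?enum_uniq //=.
- rewrite big_enum_cond /=; apply: eq_bigl => b.
  by rewrite mem_setE andbb.
- by move=> b; rewrite /= mem_enum.
- by move=> b /= Qb; rewrite mem_enum; case/negP.
Qed.

Lemma behaviour_measurable (R : realType) n (A : algorithm R n) b :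
  measurable (@behaviour_of _ _ A @^-1` [set b]).
Proof.
have -> : @behaviour_of _ _ A @^-1` [set b] =
    \bigcap_(tr in setT) (fun w => select (tagged tr) w) @^-1` [set b tr].
  apply/seteqP; split=> [w /= <- tr _ /=|w bw /=]; first by rewrite ffunE.
  by apply/ffunP => tr; rewrite ffunE; apply: bw.
apply: fin_bigcap_measurable => [|tr _]; first exact: finite_finset.
by rewrite -[X in measurable X]setTI; apply: select_measurable.
Qed.

(** Success depends on the seed only through the induced behaviour, so this law on a finite type can
    replace the seed space. *)
Definition behaviour_law (R : realType) n (A : algorithm R n) (b : behaviour n) : R :=
  fine (seed_law A (@behaviour_of _ _ A @^-1` [set b])).

Lemma seed_law_finE (R : realType) n (A : algorithm R n) (Q : pred (behaviour n)) :
  seed_law A [set w | Q (behaviour_of w)] =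
  (\sum_b behaviour_law A b * (Q b)%:R)%:E.
Proof.
rewrite measure_finite_image; last exact: behaviour_measurable.
rewrite -sumEFin big_mkcond /=; apply: eq_bigr => b _; rewrite EFinM.
case: (Q b); rewrite ?mule0 // mule1 /behaviour_law fineK //.
by rewrite fin_num_measure //; apply: behaviour_measurable.
Qed.

Lemma behaviour_law_dist (R : realType) n (A : algorithm R n) :
  is_distribution (behaviour_law A).
Proof.
split=> [b|]; first by rewrite fine_ge0.
have := @seed_law_finE R n A predT.
rewrite (_ : [set _ | _] = setT); last by apply/seteqP; split.
rewrite probability_setT => -[->].
by apply: eq_bigr => b _; rewrite mulr1.
Qed.

Lemma success_probE (R : realType) n (p : 'S_n -> R) (A : algorithm R n) v :
  success_prob p A v =
  (\sum_pi p pi *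
     \sum_b behaviour_law A b * (behaviour_succeeds v pi b)%:R)%:E.
Proof.
rewrite -sumEFin; apply: eq_bigr => pi _; rewrite EFinM; congr (_ * _)%E.
rewrite -seed_law_finE; congr (seed_law A _).
by apply/seteqP; split=> w /succeedsP.
Qed.

(** * Comparison of the two bounds for a given set of orders *)

Lemma sum_dist_le (R : realType) (T : finType) (p : T -> R) (F : T -> R) (b : R) :
  is_distribution p -> (forall x, F x <= b) -> \sum_x p x * F x <= b.
Proof.
move=> [p0 p1] Fb; rewrite -[leRHS]mul1r -p1 mulr_suml.
by apply: ler_sum => x _; apply: ler_wpM2l.
Qed.

(** The left side bounds the averaged payoff from below, as every layered assignment is won with
    probability at least [c]. By linearity the payoff is an average over orders and behaviours:
    orders in [S] obey the upper bound, the others the trivial bound [s]. *)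
Lemma success_layered_bound (R : realType) n (p : 'S_n -> R) (A : algorithm R n)
    (S : {set 'S_n}) (c d e k : R) (s : nat) : (0 < n)%N ->
  is_distribution p -> 0 <= c -> 0 < d ->
  (forall v : 'I_n -> R, injective v -> (c%:E <= success_prob p A v)%E) ->
  \sum_(pi in ~: S) p pi <= e ->
  k = (2 ^ #|S|)%:R ^+ s / n%:R ->
  c * s%:R - c * s%:R ^+ 2 * k <= 2 / d + d * s%:R + s%:R / d * k + e * s%:R.
Proof.
move=> n0 pD c0 d0 Asucc pS kE.
(* A signature is a subset of [S], whence [K = 2 ^ #|S|]. *)
pose sig (x y : 'I_n) : {set 'S_n} := [set q in S | (q x < q y)%N].
pose g (pi : 'S_n) (b : behaviour n) (l : seq 'I_n) : R :=
   (behaviour_succeeds (layer_value R l) pi b)%:R.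
pose G (l : seq 'I_n) : R := \sum_pi p pi * \sum_b behaviour_law A b * g pi b l.
have leK x (M : {set 'I_n}) : (#|sig x @: M| <= 2 ^ #|S|)%N.
  rewrite -card_powerset subset_leq_card //.
  apply/fintype.subsetP => _ /imsetP[y _ ->].
  by rewrite inE; apply/fintype.subsetP => q; rewrite inE => /andP[].
have Gc l : c <= G l.
  by have := Asucc _ (@layer_value_inj R n l); rewrite success_probE lee_fin.
have cardI : #|[set: 'I_n]%SET| = n by rewrite cardsT card_ord.
have := @layered_sum_ge R _ _ sig G _ c s [::] [set: 'I_n]%SET c0 leK Gc.
rewrite cardI n0 => /(_ isT); rewrite -[_ / n%:R]mulrA -kE => /le_trans; apply.
rewrite layered_sum_lin.
under eq_bigr do rewrite layered_sum_lin.
have blD := behaviour_law_dist A.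
set u := 2 / d + d * s%:R + s%:R / d * k.
have u0 : 0 <= u.
  by rewrite /u kE !addr_ge0 ?mulr_ge0 ?invr_ge0 ?exprn_ge0 // ltW.
have upper pi b : pi \in S -> layered_sum sig (g pi b) s [::] [set: 'I_n]%SET <= u.
  move=> piS; pose sel (l : seq 'I_n) x :=
    behaves b (observed (layer_value R l) pi (pi x)).
  have -> : u = 2 / d + d * s%:R +
      s%:R * (2 ^ #|S|)%:R ^+ s / d / #|[set: 'I_n]%SET|%:R.
    by rewrite /u kE cardI; ring.
  apply: (@layered_sum_upper R _ _ sig (fun x => nat_of_ord (pi x)) sel) => //.
  - by move=> x y /val_inj /perm_inj.
  - by move=> l x z xz; rewrite /sel observed_layer_value.
  - by move=> x y z /setP /(_ pi); rewrite !inE piS.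
  - by move=> l x; rewrite /g; case: behaviour_succeeds.
  - move=> l x xl nsel; rewrite /g; case: (boolP (behaviour_succeeds _ _ _)) => //.
    move=> /existsP[t /and3P[st /forallP nst /forallP mt]]; case/negP: nsel.
    have tx : t = pi x.
      by rewrite -(layer_value_last xl (mt x)) permKV.
    rewrite /sel -tx st; apply/forallP => y; apply/implyP => yt.
    by move: (nst (pi y)); rewrite yt.
apply: le_trans (_ : \sum_pi p pi * (u + (pi \in ~: S)%:R * s%:R) <= _).
  apply: ler_sum => pi _; rewrite ler_wpM2l ?(proj1 pD) //.
  apply: sum_dist_le => // b; rewrite inE; have [piS|piS] /= := boolP (pi \in S).
    by rewrite mul0r addr0 upper.
  rewrite mul1r -[leLHS]add0r lerD //; apply: layered_sum_le => l.
  by rewrite /g; case: behaviour_succeeds.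
under eq_bigr do rewrite mulrDr.
rewrite big_split /= -mulr_suml (proj2 pD) mul1r lerD2l.
under eq_bigr do rewrite mulrA.
rewrite -mulr_suml ler_wpM2r //; apply: le_trans pS.
rewrite [leRHS]big_mkcond; apply: ler_sum => pi _.
by case: (pi \in _); rewrite ?mulr1 ?mulr0.
Qed.

(** * Concentration of laws of small entropy *)

Section Truncation.
Variables (R : realType) (T : finType) (p : T -> R) (L : R).
Hypothesis pD : is_distribution p.

Let heavy := [set x | expR (- L) <= p x]%SET.

Lemma card_heavy : #|heavy|%:R <= expR L.
Proof.
have [p0 p1] := pD.
rewrite -[leRHS]mul1r -[expR L]invrK -expRN ler_pdivlMr ?expR_gt0 // -[leRHS]p1.
rewrite mulr_natl -sumr_const [leRHS](bigID (mem heavy)) /= -[leLHS]addr0.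
by rewrite lerD ?sumr_ge0 //; apply: ler_sum => x; rewrite inE.
Qed.

(** Markov's inequality for [- ln p], which exceeds [L] at light points of positive mass and is
    nonnegative wherever [p] is positive, as [p <= 1]. *)
Lemma light_mass : 0 < L -> \sum_(x in ~: heavy) p x <= entropy p / L.
Proof.
move=> L0; have [p0 p1] := pD; rewrite ler_pdivlMr // mulr_suml /entropy -sumrN.
rewrite [leRHS](bigID (mem (~: heavy))) /= -[leLHS]addr0 lerD //.
  apply: ler_sum => x; rewrite !inE -ltNge => px.
  have [->|nz] := eqVneq (p x) 0; first by rewrite !mul0r oppr0.
  have px0 : 0 < p x by rewrite lt_neqAle eq_sym nz p0.
  rewrite -mulrN ler_pM2l // -[L]opprK lerN2 -ler_expR lnK //; exact: ltW.
apply: sumr_ge0 => x _; rewrite -mulrN mulr_ge0 // oppr_ge0 ln_le0 //.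
by rewrite -p1 (bigD1 x) //= lerDl sumr_ge0.
Qed.
End Truncation.

(** * Choice of parameters and conclusion *)

Lemma exp_ratio_le (R : realType) (y : R) (k s : nat) (x : R) :
  s.+1%:R <= y -> k%:R <= y -> expR (y ^+ 2) <= x ->
  (2 ^ k)%:R ^+ s / x <= y^-1.
Proof.
move=> sy ky xy.
have y0 : 0 < y by apply: lt_le_trans sy.
have x0 : 0 < x by apply: lt_le_trans xy; apply: expR_gt0.
(* From [2 <= e], the numerator is at most [exp (s * y)], and [y * exp (s * y) <= exp ((s + 1) * y)
   <= exp (y ^ 2)]. *)
rewrite ler_pdivrMr //; apply: le_trans (_ : expR (s%:R * y) <= _).
  rewrite expRM_natl lerXn2r ?nnegrE ?expR_ge0 //.
  rewrite natrX; apply: le_trans (_ : expR 1 ^+ k <= _).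
    by rewrite lerXn2r ?nnegrE ?expR_ge0 //; have := expR_ge1Dx (1 : R); lra.
  by rewrite -expRM_natl mulr1 ler_expR.
rewrite -(ler_pM2l y0) mulVKf ?gt_eqF //; apply: le_trans xy.
apply: le_trans (_ : expR y * expR (s%:R * y) <= _).
  rewrite ler_pM2r ?expR_gt0 //; apply: le_trans (expR_ge1Dx y).
  by rewrite lerDr.
rewrite -expRD ler_expR -{1}[y]mul1r -mulrDl expr2 ler_pM2r //.
by rewrite nat1r.
Qed.

Theorem mainTheorem9 (R : realType) (D : forall n : nat, 'S_n -> R)
    (hD : forall n : nat, (0 < n)%N -> is_distribution (D n))
    (hH : (fun n : nat => entropy (D n) : R^o) =o_\oo
          (fun n : nat => ln (ln (n%:R : R)) : R^o)) :
  ~ s_admissible D.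
Proof.
move=> [c [n0 [c0 adm]]].
(* With [d = c / 8] and [e = c / 2], the final inequality times [c] gives [3 / 8 * c ^ 2 * s <= 16 +
   (c ^ 2 * s ^ 2 + 8 * s) * k <= 17], which contradicts [c ^ 2 * s > 128]. *)
pose s := (Num.truncn (128 / c ^+ 2)).+1.
have sc : 128 / c ^+ 2 < s%:R by apply: truncnS_gt.
(* For [y >= Y], the first summand gives [k <= 1 / y], and the second then makes the total error
   involving [k] at most [1]. *)
pose Y : R := s.+1%:R + (c ^+ 2 * s%:R ^+ 2 + 8 * s%:R).
have q0 : 0 < c ^+ 2 * s%:R ^+ 2 + 8 * s%:R :> R.
  by rewrite addr_gt0 ?mulr_gt0 ?exprn_gt0 ?ltr0n.
have Y1 : 1 < Y by rewrite ltr_pwDr // ler1n.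
have Y0 : 0 < Y by lra.
have c4 : 0 < c / 4 by rewrite divr_gt0.
have [N _ hN] := (eqoP _ _ _).1 hH (c / 4) c4.
pose n := maxn (maxn N n0) (Num.truncn (expR (Y ^+ 2))).+1.
have nN : (N <= n)%N by rewrite !leq_max leqnn.
have nn0 : (n0 <= n)%N by rewrite !leq_max leqnn orbT.
have npos : (0 < n)%N by rewrite !leq_max orbT.
have nY : expR (Y ^+ 2) <= n%:R.
  apply: le_trans (ltW (truncnS_gt _)) _; rewrite ler_nat leq_max leqnn orbT //.
have nR0 : 0 < n%:R :> R by rewrite ltr0n.
pose x : R := ln n%:R.
have xY : Y ^+ 2 <= x by rewrite -ler_expR lnK.
have x0 : 0 < x by apply: lt_le_trans xY; rewrite exprn_gt0.
(* This makes [exp L] the square root of [ln n]; as [L] is half of [ln (ln n)], the entropy bound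
   with [c / 4] leaves light mass at most [c / 2]. *)
pose L : R := ln x / 2.
pose y := expR L.
have yx : y ^+ 2 = x by rewrite -expRM_natl mulrCA divff // mulr1 lnK.
have y0 : 0 < y by apply: expR_gt0.
have Yy : Y <= y by rewrite -(@ler_pXn2r _ 2) ?nnegrE ?(ltW Y0) ?(ltW y0) ?yx.
have L0 : 0 < L by rewrite -ltr_expR expR0 -/y; lra.
have HL : entropy (D n) / L <= c / 2.
  rewrite ler_pdivrMr //; apply: le_trans (ler_norm _) _.
  apply: le_trans (hN n nN) _ => /=.
  rewrite -/x ger0_norm; last by move: L0; rewrite /L; lra.
  rewrite /L; lra.
have [A hA] := adm n npos nn0.
set S := [set pi | expR (- L) <= D n pi]%SET.
have Sy : #|S|%:R <= y by apply: card_heavy; apply: hD.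
have lS : \sum_(pi in ~: S) D n pi <= c / 2.
  by apply: le_trans HL; apply: light_mass => //; apply: hD.
pose k : R := (2 ^ #|S|)%:R ^+ s / n%:R.
have c8 : 0 < c / 8 by rewrite divr_gt0.
have main := @success_layered_bound _ _ _ _ _ _ _ _ k s npos (hD n npos)
  (ltW c0) c8 hA lS erefl.
have ky : k <= y^-1.
  apply: exp_ratio_le => //; last by rewrite yx lnK.
  apply: le_trans Yy; rewrite /Y; lra.
have kq : (c ^+ 2 * s%:R ^+ 2 + 8 * s%:R) * k <= 1.
  apply: le_trans (_ : y * k <= _); last by rewrite mulrC -ler_pdivlMr ?mul1r.
  rewrite ler_wpM2r ?divr_ge0 ?exprn_ge0 //.
  apply: le_trans Yy; rewrite /Y lerDr //.
have {}main : c * (c * s%:R - c * s%:R ^+ 2 * k) <=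
   c * (2 / (c / 8) + c / 8 * s%:R + s%:R / (c / 8) * k + c / 2 * s%:R).
  by rewrite ler_pM2l.
have E : c * (2 / (c / 8) + c / 8 * s%:R + s%:R / (c / 8) * k + c / 2 * s%:R) =
  16 + c ^+ 2 * s%:R / 8 + 8 * s%:R * k + c ^+ 2 * s%:R / 2.
  by field; rewrite gt_eqF.
have sc' : 128 < c ^+ 2 * s%:R by rewrite mulrC -ltr_pdivrMr // exprn_gt0.
rewrite {}E in main; move: main kq sc'; move: (s%:R : R) (k : R).
by clear=> z k; lra.
Qed.
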